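(* Let $r \ge 2$ be an integer, let $\alpha \in \left( \frac{r-2}{r-1},\frac{r-1}{r} \right]$, let $H$ be a fixed graph with chromatic number $r$, and let $G_\alpha$ be a graph on $n$ vertices with minimum degree $\delta(G_{\alpha}) \geq \alpha n$. Then, provided that $n$ is large enough, the following holds: in the $(1:1)$ Maker-Breaker game played on the edge set of $G_{\alpha}$, Maker has a strategy to claim (the edges of) a copy of $H$.
   Context: A $(1:b)$ Maker-Breaker game on a board $X$ (here a set of edges) with a family of winning sets $\mathcal{F}\subseteq 2^X$: Maker and Breaker alternately claim previously unclaimed elements of $X$, Maker claiming $1$ element per round and Breaker claiming $b$ elements per round (possibly fewer in the last round). Maker wins if she claims all elements of some $F \in \mathcal{F}$; otherwise Breaker wins. In the $H$-game the winning sets are the edge sets of copies of $H$ in the host graph. *)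

(* Defs.v *)
From mathcomp Require Import all_boot.

Set Implicit Arguments.
Unset Strict Implicit.
Unset Printing Implicit Defensive.

Record sgraph := SGraph {
  svertex :> finType;
  adj : rel svertex;
  adj_sym : symmetric adj;
  adj_irrefl : irreflexive adj
}.

Definition edges (G : sgraph) : {set {set G}} :=
  [set [set x; y] | x in G, y in G & adj x y].

Definition degree (G : sgraph) (x : G) : nat := #|[set y : G | adj x y]|.

(* The default #|G| exceeds every degree, so it only matters when G has no
   vertex. *)
Definition min_degree (G : sgraph) : nat :=
  \big[minn/#|G|]_(x : G) degree x.

Definition colorable (G : sgraph) (k : nat) : bool :=
  [exists f : {ffun G -> 'I_k}, forall x, forall y, adj x y ==> (f x != f y)].

Lemma colorable_ex (G : sgraph) : exists k, colorable G k.
Proof.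
exists #|G|; apply/existsP; exists [ffun x => enum_rank x].
apply/forallP => x; apply/forallP => y; apply/implyP => xy.
rewrite !ffunE (inj_eq enum_rank_inj).
by apply: contraTneq xy => ->; rewrite adj_irrefl.
Qed.

Definition chromatic_number (G : sgraph) : nat := ex_minn (colorable_ex G).

(* Copies need not be induced. *)
Definition embedding (H G : sgraph) (f : {ffun H -> G}) : bool :=
  injectiveb f && [forall x, forall y, adj x y ==> adj (f x) (f y)].

Definition copies (H G : sgraph) : {set {set {set G}}} :=
  [set [set [set f v | v in e] | e : {set H} in edges H]
     | f : {ffun H -> G} & embedding f].

Inductive player := Maker | Breaker.

Definition opponent (p : player) : player :=
  if p is Maker then Breaker else Maker.

Section MakerBreaker.

Variable T : finType.

(* The sets claimed at the successive turns, oldest first. *)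
Definition history := seq {set T}.

Definition unclaimed (X : {set T}) (h : history) : {set T} :=
  X :\: \bigcup_(A <- h) A.

(* The player to move claims exactly q unclaimed elements, or all of them if
   fewer than q are left. *)
Definition legal_move (q : nat) (X : {set T}) (h : history) (A : {set T}) :=
  (A \subset unclaimed X h) && (#|A| == minn q #|unclaimed X h|).

Definition strategy := history -> {set T}.

Definition valid_strategy (q : nat) (X : {set T}) (s : strategy) : Prop :=
  forall h, legal_move q X h (s h).

Definition mover (first : player) (i : nat) : player :=
  if odd i then opponent first else first.

Fixpoint play (first : player) (sM sB : strategy) (n : nat) : history :=
  if n is m.+1 then
    let h := play first sM sB m in
    rcons h (if mover first m is Maker then sM h else sB h)
  else [::].

Fixpoint maker_claimed (first : player) (h : history) : {set T} :=
  if h is A :: h' then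
    (if first is Maker then A else set0)
      :|: maker_claimed (opponent first) h'
  else set0.

(* Maker has a winning strategy in the (1:b) game on the board X with winning
   sets F, where the given player makes the first move. *)
Definition maker_wins (b : nat) (X : {set T}) (F : {set {set T}})
    (first : player) : Prop :=
  exists2 sM : strategy, valid_strategy 1 X sM &
    forall sB : strategy, valid_strategy b X sB ->
      exists n : nat, exists2 W : {set T}, W \in F &
        W \subset maker_claimed first (play first sM sB n).

End MakerBreaker.

Definition maker_wins_H_game (b : nat) (H G : sgraph) (first : player) : Prop :=
  maker_wins b (edges G) (copies H G) first.

(* Main.v *)
(* The degree condition gives every set of fewer than r vertices linearly many common
   neighbours, so a positive proportion of the maps from a transversal of the r colour classes
   of H to G are cliques; cloning a vertex keeps at least the square of the density
   (Cauchy-Schwarz), so a positive proportion of all maps H -> G are homomorphisms, and almost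
   all of these are injective.  Thus G has order n^|H| embeddings of H, but only O(n^(|H|-3)) of
   them use two given edges.  Beck's potential criterion now applies: a copy not yet touched by
   Breaker weighs 2^(number of its edges owned by Maker), and Maker always claims the edge for
   which the copies through it have the largest total weight.  Each round then decreases the
   total weight by at most O(n^(|H|-3)), so at most n^2 rounds cannot bring it down to 0. *)
Require Import Defs.
From mathcomp Require Import all_boot all_order all_algebra reals.
From mathcomp Require Import zify ring lra.

Import Order.TTheory GRing.Theory Num.Theory.

Set Implicit Arguments.
Unset Strict Implicit.
Unset Printing Implicit Defensive.

(** * Beck's potential and its change under single moves *)

Section Beck.
Variables (T I : finType) (P : {set I}) (E : I -> {set T}).
Implicit Types (M B : {set T}) (x y : T).

(** Winning sets are indexed by [I], hence counted with multiplicity; later the indices are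
    embeddings. *)
Definition potential (M B : {set T}) : nat :=
  \sum_(i in P | [disjoint E i & B]) 2 ^ #|E i :&: M|.

Definition danger (M B : {set T}) (x : T) : nat :=
  \sum_(i in P | [disjoint E i & B] && (x \in E i)) 2 ^ #|E i :&: M|.

(** Live members through [x] double their weight, so the gain is their former total weight. *)
Lemma potential_maker M B x : x \notin M ->
  potential (x |: M) B = potential M B + danger M B x.
Proof.
move=> xM; rewrite /potential /danger (bigID (fun i => x \in E i)) /=.
rewrite [in RHS](bigID (fun i => x \in E i)) /= addnAC.
under [X in _ = _ + X + _]eq_bigl => i do rewrite andbA.
rewrite -big_split /=; congr (_ + _); apply: eq_bigr => i /andP[_ xi].
- have -> : E i :&: (x |: M) = x |: (E i :&: M).
    by apply/setP => y; rewrite !inE; case: eqP => // ->; rewrite xi.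
  by rewrite cardsU1 !inE (negPf xM) andbF expnS mul2n addnn.
- congr (2 ^ #|pred_of_set _|); apply/setP => y; rewrite !inE.
  by case: eqP => // ->; rewrite (negPf xi).
Qed.

Lemma potential_breaker M B y :
  potential M B = potential M (y |: B) + danger M B y.
Proof.
rewrite /potential /danger (bigID (fun i => y \in E i)) /= addnC.
congr (_ + _); apply: eq_bigl => i; rewrite ?andbA //.
rewrite -!andbA; congr (_ && _).
by rewrite ![[disjoint E i & _]]disjoint_sym -!setI_eq0 setIUl setU_eq0 !setI_eq0
  disjoints1 andbC.
Qed.

Variables (e D : nat).
Hypothesis E_small : {in P, forall i, #|E i| <= e}.
Hypothesis E_codegree :
  forall x y, x != y -> #|[set i in P | (x \in E i) && (y \in E i)]| <= D.

(* Claiming [x] only raises the danger of [y] through the members containing both. *)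
Lemma danger_maker M B x y : x != y ->
  danger (x |: M) B y <= danger M B y + 2 ^ e * D.
Proof.
move=> xy; pose Q := [set i in P | (x \in E i) && (y \in E i)].
apply: (@leq_trans (danger M B y + \sum_(i in Q) 2 ^ e)); last first.
  by rewrite leq_add2l sum_nat_const mulnC leq_mul2l E_codegree ?orbT.
rewrite /danger (bigID (fun i => x \in E i)) /= addnC leq_add //.
- rewrite [leqRHS](bigID (fun i => x \in E i)) /= -[leqLHS]add0n leq_add //.
  rewrite leq_eqVlt; apply/orP; left; apply/eqP; apply: eq_bigr => i /andP[_ xi].
  congr (2 ^ #|pred_of_set _|); apply/setP => z; rewrite !inE.
  by case: eqP => // ->; rewrite (negPf xi).
- rewrite [leqRHS](bigID (fun i => [disjoint E i & B])) /= -[leqLHS]addn0 leq_add //.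
  rewrite [leqLHS](eq_bigl (fun i => (i \in Q) && [disjoint E i & B])).
    apply: leq_sum => i /andP[]; rewrite inE => /andP[iP _] _.
    by rewrite leq_exp2l // (leq_trans _ (E_small iP)) // subset_leq_card // subsetIl.
  move=> i; rewrite inE.
  by case: (i \in P); case: (x \in E i); case: (y \in E i); case: [disjoint _ & _].
Qed.

(** Maker gains at least the old danger of [y], while Breaker destroys its danger after Maker's
    move; the net loss is at most the growth of that danger. *)
Lemma potential_round M B x y :
    x \notin M -> x != y -> danger M B y <= danger M B x ->
  potential M B <= potential (x |: M) (y |: B) + 2 ^ e * D.
Proof.
move=> xM xy yx; have := danger_maker M B xy.
have := potential_maker B xM; have := potential_breaker (x |: M) B y; lia.
Qed.

End Beck.

(** * Bookkeeping for plays of the (1:1) game *)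

Section Play.
Variable T : finType.
Implicit Types (h : history T) (A X : {set T}).

Lemma size_play first (sM sB : strategy T) n : size (play first sM sB n) = n.
Proof. by elim: n => //= n IH; rewrite size_rcons IH. Qed.

Lemma mover_opponent p i : mover (opponent p) i = opponent (mover p i).
Proof. by rewrite /mover; case: (odd i); case: p. Qed.

Lemma maker_claimed_rcons first h A :
  maker_claimed first (rcons h A) =
  maker_claimed first h :|: (if mover first (size h) is Maker then A else set0).
Proof.
elim: h first => [|B h IH] first /=; first by rewrite setU0 set0U.
rewrite IH setUA; congr (_ :|: _); rewrite mover_opponent /mover /=.
by case: (odd _); case: first.
Qed.

(** With the first player swapped, [maker_claimed] collects exactly Breaker's turns; this is how
    Breaker's set is written from here on. *)
Lemma claimedE first h :
  \bigcup_(A <- h) A = maker_claimed first h :|: maker_claimed (opponent first) h.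
Proof.
elim: h first => [|B h IH] first /=; first by rewrite big_nil setU0.
rewrite big_cons (IH (opponent first)) /=.
have -> : opponent (opponent first) = first by case: first.
by case: first; apply/setP => z; rewrite !inE /=; case: (z \in B); rewrite ?orbT.
Qed.

Lemma unclaimed_rcons X h A : unclaimed X (rcons h A) = unclaimed X h :\: A.
Proof. by rewrite /unclaimed big_rcons /= setDDl. Qed.

Lemma card_unclaimed_play X first (sM sB : strategy T) n :
    valid_strategy 1 X sM -> valid_strategy 1 X sB ->
  #|unclaimed X (play first sM sB n)| <= #|X| - n.
Proof.
move=> vM vB; elim: n => [|n IH] /=.
  by rewrite subn0 subset_leq_card // subsetDl.
rewrite unclaimed_rcons; set h := play _ _ _ n in IH *.
set A := (X in _ :\: X).
have /andP[sA /eqP cA] : legal_move 1 X h A.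
  by rewrite /A; case: (mover _ _).
rewrite cardsD (setIidPr sA) cA; lia.
Qed.

Lemma legal_move1 X h A : legal_move 1 X h A ->
  [\/ A = set0 /\ unclaimed X h = set0 | exists2 x, x \in unclaimed X h & A = [set x]].
Proof.
case/andP=> sA /eqP; case: (set_0Vmem (unclaimed X h)) => [u0|[x xu]].
  by rewrite u0 cards0 minn0 => /eqP; rewrite cards_eq0 => /eqP ->; left.
have -> : minn 1 #|unclaimed X h| = 1.
  by apply/minn_idPl; rewrite card_gt0; apply/set0Pn; exists x.
move/eqP/cards1P=> [y Ay]; right; exists y => //.
by rewrite (subsetP sA) // Ay set11.
Qed.

End Play.

(** * A potential criterion for Maker's win *)

Section Criterion.
Variables (T I : finType) (X : {set T}) (F : {set {set T}}).
Variables (P : {set I}) (E : I -> {set T}) (e D1 D2 : nat).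
Hypothesis EF : {in P, forall i, E i \in F}.
Hypothesis EX : {in P, forall i, E i \subset X}.
Hypothesis E_small : {in P, forall i, #|E i| <= e}.
Hypothesis E_degree : forall x, #|[set i in P | x \in E i]| <= D1.
Hypothesis E_codegree :
  forall x y, x != y -> #|[set i in P | (x \in E i) && (y \in E i)]| <= D2.

(** The picked [x0] only serves as the default of the arg max. On an exhausted board the empty set
    is the one legal move. *)
Definition potential_strategy first : strategy T := fun h =>
  if [pick x in unclaimed X h] is Some x0 then
    [set [arg max_(x > x0 in unclaimed X h)
       danger P E (maker_claimed first h) (maker_claimed (opponent first) h) x]]
  else set0.

Lemma potential_strategy_valid first : valid_strategy 1 X (potential_strategy first).
Proof.
move=> h; rewrite /legal_move /potential_strategy.
case: pickP => [x0 x0u|u0].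
  case: arg_maxnP => // x xu _; rewrite sub1set xu cards1 /=.
  by apply/eqP/esym/minn_idPl; rewrite card_gt0; apply/set0Pn; exists x.
by rewrite sub0set (eq_card0 u0) minn0 cards0.
Qed.

Lemma potential_strategyP first h x y :
    potential_strategy first h = [set x] -> y \in unclaimed X h ->
  danger P E (maker_claimed first h) (maker_claimed (opponent first) h) y
  <= danger P E (maker_claimed first h) (maker_claimed (opponent first) h) x.
Proof.
rewrite /potential_strategy => Ex yu; move: Ex.
case: pickP => [x0 x0u|u0]; last by have := u0 y; rewrite /= yu.
by case: arg_maxnP => // z zu zmax /set1_inj <-; apply: zmax.
Qed.

(** The play is cut into [k] rounds in which Maker moves before Breaker. If Breaker starts, his
    opening turn stands alone and destroys at most [D1] members, all still of weight 1. *)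
Lemma play_potential first (sB : strategy T) k h : valid_strategy 1 X sB ->
    h = play first (potential_strategy first) sB
          (2 * k + (if first is Maker then 0 else 1)) ->
  #|P| <= potential P E (maker_claimed first h) (maker_claimed (opponent first) h)
           + k * (2 ^ e * D2) + D1.
Proof.
move=> vB; elim: k h => [|k IH] h ->.
  have P0 : potential P E set0 set0 = #|P|.
    rewrite /potential -sum1_card; apply: eq_big => [i|i _].
      by rewrite -setI_eq0 setI0 eqxx andbT.
    by rewrite setI0 cards0.
  rewrite muln0 mul0n add0n addn0; case: first => /=.
    by rewrite P0 leq_addr.
  rewrite setU0.
  case: (legal_move1 (vB [::])) => [[-> _]|[y _ ->]].
    by rewrite setU0 P0 leq_addr.
  rewrite -P0 (potential_breaker P E set0 set0 y) ?setU0 ?addn0 leq_add2l.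
  apply: leq_trans (E_degree y); rewrite /danger -sum1_card.
  rewrite (eq_bigl (mem [set i in P | y \in E i])) => [|i]; last first.
    by rewrite !inE -setI_eq0 setI0 eqxx.
  by apply: leq_sum => i _; rewrite setI0 cards0.
pose N := 2 * k + (if first is Maker then 0 else 1).
have EN : 2 * k.+1 + (if first is Maker then 0 else 1) = N.+2 by rewrite /N; lia.
have oddN : odd N = (if first is Maker then false else true).
  by rewrite /N mul2n oddD odd_double; case: (first).
rewrite EN /=; move/(_ _ erefl): IH; rewrite -/N.
set g := play _ _ _ N.
have -> : mover first N = Maker by rewrite /mover oddN; case: (first).
have -> : mover first N.+1 = Breaker by rewrite /mover /= oddN; case: (first).
set A := potential_strategy first g; set B := sB (rcons g A).
rewrite !maker_claimed_rcons !size_rcons !size_play !mover_opponent.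
have -> : mover first N = Maker by rewrite /mover oddN; case: (first).
have -> : mover first N.+1 = Breaker by rewrite /mover /= oddN; case: (first).
rewrite /= !setU0.
set M := maker_claimed first g; set O := maker_claimed (opponent first) g.
move=> IH; apply: leq_trans IH _.
have claimed : \bigcup_(C <- g) C = M :|: O by apply: claimedE.
suff : potential P E M O <= potential P E (M :|: A) (O :|: B) + 2 ^ e * D2 by lia.
(* On an exhausted board both moves are empty; if only Breaker finds nothing left, the potential
   does not drop. *)
case: (legal_move1 (potential_strategy_valid first g)) => [[A0 u0]|[x xu Ax]].
  have A00 : A = set0 by [].
  case: (legal_move1 (vB (rcons g A))) => [[B0 _]|[y]]; last first.
    by rewrite unclaimed_rcons u0 set0D inE.
  by rewrite /B B0 A00 !setU0 leq_addr.
have A1 : A = [set x] by [].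
have xM : x \notin M by move: xu; rewrite /unclaimed claimed !inE !negb_or -andbA => /andP[].
case: (legal_move1 (vB (rcons g A))) => [[B0 _]|[y yu B1]].
  by rewrite /B B0 setU0 A1 setUC potential_maker //; lia.
rewrite /B B1 A1 ![_ :|: [set _]]setUC.
move: yu; rewrite unclaimed_rcons A1 !inE -/(unclaimed X g) => /andP[yx yu].
apply: potential_round => //; first by rewrite eq_sym.
by apply: potential_strategyP => //; rewrite inE.
Qed.

(** After [N >= #|X|] turns the board is exhausted. Positive potential then yields a member avoiding
    Breaker's set, so Maker owns all of it. *)
Lemma maker_wins_potential first :
  #|X| * (2 ^ e * D2) + D1 < #|P| -> maker_wins 1 X F first.
Proof.
move=> big; exists (potential_strategy first).
  exact: potential_strategy_valid.
move=> sB vB; pose N := 2 * #|X| + (if first is Maker then 0 else 1); exists N.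
pose h := play first (potential_strategy first) sB N; rewrite -/h.
have bound := play_potential (k := #|X|) vB (erefl h).
have : #|unclaimed X h| <= #|X| - N.
  by apply: card_unclaimed_play => //; apply: potential_strategy_valid.
have -> : #|X| - N = 0 by rewrite /N; lia.
rewrite leqn0 cards_eq0 setD_eq0 (claimedE first) => Xh.
have : 0 < potential P E (maker_claimed first h) (maker_claimed (opponent first) h).
  by move: (leq_trans big bound); rewrite -addnA -[ltnLHS]add0n ltn_add2r.
rewrite lt0n sum_nat_eq0 => /forallPn[i]; rewrite negb_imply => /andP[/andP[iP dis] _].
exists (E i); first exact: EF.
apply/subsetP => x xi; have := subsetP Xh x (subsetP (EX iP) x xi).
by rewrite inE => /orP[//|xO]; rewrite (disjointFr dis xi) in xO.
Qed.

End Criterion.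

(** * Averaging over one value of a map, and elementary estimates *)

Section Update.
Variables U V : finType.
Implicit Types (f : {ffun U -> V}) (u : U) (x : V).

Definition update f u x : {ffun U -> V} := [ffun w => if w == u then x else f w].

Lemma updateE f u x : update f u x u = x.
Proof. by rewrite ffunE eqxx. Qed.

Lemma update_neq f u x w : w != u -> update f u x w = f w.
Proof. by rewrite ffunE => /negPf ->. Qed.

(** Exchanging [f u] with the spare value [x] is an involution on the pairs [(f, x)]. *)
Lemma sum_update (F : {ffun U -> V} -> nat) u :
  \sum_f \sum_x F (update f u x) = #|V| * \sum_f F f.
Proof.
pose swap (p : {ffun U -> V} * V) := (update p.1 u p.2, p.1 u).
have swapK : involutive swap.
  move=> [f x]; rewrite /swap /= updateE; congr (_, _); apply/ffunP => w.
  by rewrite !ffunE; case: eqP => // ->.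
rewrite pair_big (reindex_inj (inv_inj swapK)) /=.
rewrite (eq_bigr (fun p => F p.1)) => [|p _]; last first.
  by congr F; rewrite -[in RHS](swapK p).
rewrite -(pair_big predT predT (fun f _ => F f)) /= big_distrr /=.
by apply: eq_bigr => f _; rewrite sum_nat_const.
Qed.

End Update.

(** Cauchy-Schwarz, by summing [2 * (a i * a j) <= a i ^ 2 + a j ^ 2] over all pairs. *)
Lemma sum_sqr_le (I : finType) (a : I -> nat) :
  (\sum_i a i) ^ 2 <= #|I| * \sum_i a i ^ 2.
Proof.
rewrite -(leq_pmul2l (isT : 0 < 2)).
have -> : (\sum_i a i) ^ 2 = \sum_i \sum_j a i * a j.
  by rewrite expnS expn1 big_distrlr.
apply: (@leq_trans (\sum_i \sum_j (a i ^ 2 + a j ^ 2))).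
  rewrite big_distrr leq_sum // => i _; rewrite big_distrr leq_sum // => j _.
  exact: nat_Cauchy.
under eq_bigr => i _ do rewrite big_split sum_nat_const /=.
rewrite big_split /= -big_distrr sum_nat_const /=.
by rewrite addnn mul2n.
Qed.

Lemma card_setE (T : finType) (A : {set T}) : #|A| = \sum_x (x \in A).
Proof. by rewrite -sum1_card [LHS]big_mkcond; apply: eq_bigr => x _; case: (x \in A). Qed.

Lemma min_degree_le (G : sgraph) (x : G) : min_degree G <= degree x.
Proof.
rewrite /min_degree; have : x \in index_enum G by apply: mem_index_enum.
elim: (index_enum G) => // y s IH; rewrite inE big_cons => /orP[/eqP ->|xs].
  exact: geq_minl.
exact: leq_trans (geq_minr _ _) (IH xs).
Qed.

Lemma min_degree_le_card (G : sgraph) : min_degree G <= #|G|.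
Proof.
rewrite /min_degree; elim: (index_enum G) => [|y s IH]; first by rewrite big_nil.
by rewrite big_cons; apply: leq_trans (geq_minr _ _) IH.
Qed.

Lemma card_bigcup_le (I T : finType) (P : pred I) (A : I -> {set T}) :
  #|\bigcup_(i | P i) A i| <= \sum_(i | P i) #|A i|.
Proof.
apply: (big_ind2 (fun (B : {set T}) k => #|B| <= k)); first by rewrite cards0.
  by move=> B b C c Bb Cc; apply: leq_trans (leq_card_setU B C).1 (leq_add Bb Cc).
by [].
Qed.

(** * Supersaturation: many maps send differently coloured vertices to neighbours *)

Section Supersaturation.
Variables (U : finType) (r : nat) (c : U -> 'I_r) (G : sgraph).

(** Homomorphisms on [J] from the complete multipartite graph whose parts are the colour classes.
    Values outside [J] stay free, so that all [J] are compared inside one set of maps. *)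
Definition multipartite (J : {set U}) : {set {ffun U -> G}} :=
  [set f : {ffun U -> G} | [forall u in J, forall v in J, (c u != c v) ==> adj (f u) (f v)]].

Implicit Types (J K : {set U}) (f : {ffun U -> G}).

Lemma multipartiteP J f :
  reflect {in J &, forall u v, c u != c v -> adj (f u) (f v)} (f \in multipartite J).
Proof.
rewrite inE; apply: (iffP forall_inP) => [H u v uJ vJ cuv|H u uJ].
  by have /forall_inP/(_ v vJ)/implyP := H u uJ; apply.
by apply/forall_inP => v vJ; apply/implyP; apply: H.
Qed.

Lemma multipartite_update J u f x : u \notin J ->
  (update f u x \in multipartite J) = (f \in multipartite J).
Proof.
move=> uJ; have fJ v : v \in J -> update f u x v = f v.
  by move=> vJ; rewrite update_neq //; apply: contraNneq uJ => <-.
apply/multipartiteP/multipartiteP => H v w vJ wJ.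
  by have := H v w vJ wJ; rewrite !fJ.
by rewrite !fJ //; apply: H.
Qed.

(* Cauchy-Schwarz over the maps with the values at [u] and [u'] left free. *)
Lemma card_multipartite_clone J u u' : u \in J -> u' \notin J -> c u = c u' ->
  #|multipartite J| ^ 2 <= #|{ffun U -> G}| * #|multipartite (u' |: J)|.
Proof.
move=> uJ u'J cu.
have uu' : u != u' by apply: contraNneq u'J => <-.
have [G0|Gpos] := posnP #|G|.
  have : #|{ffun U -> G}| = 0.
    by rewrite card_ffun G0 exp0n //; apply/card_gt0P; exists u.
  move=> F0; have := max_card (mem (multipartite J)).
  by rewrite F0 leqn0 => /eqP ->.
pose S f : nat := f \in multipartite J.
pose a f := \sum_x S (update f u x).
apply: (@leq_trans (#|{ffun U -> G}| * \sum_f S f * S (update f u (f u')))); last first.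
  rewrite leq_mul2l; apply/orP; right; rewrite card_setE leq_sum // => f _.
  rewrite /S; case: multipartiteP => // Hf; case: multipartiteP => // Hg.
  rewrite muln1 lt0b; apply/multipartiteP => v w.
  have cast z : z \in J -> c z != c u -> update f u (f u') z = f z.
    by move=> _ cz; rewrite update_neq //; apply: contraNneq cz => ->.
  rewrite !inE => /orP[/eqP ->|vJ] /orP[/eqP ->|wJ]; rewrite ?eqxx // => cvw.
  - rewrite -cu in cvw; have := Hg u w uJ wJ cvw; rewrite updateE cast //.
    by rewrite eq_sym.
  - by rewrite -cu in cvw; have := Hg v u vJ uJ cvw; rewrite updateE cast.
  - exact: Hf.
(* With value [x] at [u] and [y] at [u'], the first factor depends on [x] alone and the second on
   [y] alone, since [u'] lies outside [J]. *)
have sumh : #|G| ^ 2 * \sum_f S f * S (update f u (f u')) = \sum_f a f ^ 2.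
  rewrite -mulnn -mulnA -(sum_update _ u') -(sum_update _ u) /=.
  apply: eq_bigr => f _; rewrite -mulnn /a big_distrlr /=.
  apply: eq_bigr => x _; apply: eq_bigr => y _.
  rewrite /S multipartite_update // updateE; congr (_ * nat_of_bool _).
  have -> : update (update (update f u x) u' y) u y = update (update f u y) u' y.
    apply/ffunP => w; rewrite !ffunE; case: (eqVneq w u) => // ->.
    by rewrite (negPf uu').
  by rewrite multipartite_update.
rewrite -(@leq_pmul2l (#|G| ^ 2)) ?expn_gt0 ?Gpos //.
rewrite mulnCA sumh -expnMn card_setE -(sum_update _ u).
exact: sum_sqr_le.
Qed.

Variable m : nat.
Hypothesis deg_large : #|G| + m * (r.-1 * (#|G| - min_degree G)) <= m * #|G|.

(** Each [f v] excludes at most [#|G| - min_degree G] vertices, and [deg_large] says that [r.-1]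
    such exclusions leave a proportion [1/m]. *)
Lemma card_common_neighbours (J : {set U}) (f : U -> G) : #|J| < r ->
  #|G| <= m * #|[set x : G | [forall v in J, adj (f v) x]]|.
Proof.
move=> Jr; set C := [set x | _].
have : #|~: C| <= r.-1 * (#|G| - min_degree G).
  have -> : ~: C = \bigcup_(v in J) [set x | ~~ adj (f v) x].
    apply/setP => x; rewrite !inE negb_forall_in.
    apply/exists_inP/bigcupP => -[v vJ]; first by exists v; rewrite ?inE.
    by rewrite inE; exists v.
  apply: (@leq_trans (\sum_(v in J) (#|G| - min_degree G))); last first.
    rewrite sum_nat_const leq_mul2r; apply/orP; right; lia.
  apply: leq_trans (card_bigcup_le _ _) _; apply: leq_sum => v _.
  have -> : [set x | ~~ adj (f v) x] = ~: [set x | adj (f v) x].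
    by apply/setP => x; rewrite !inE.
  by rewrite cardsCs setCK leq_sub2l //; apply: min_degree_le.
rewrite cardsCs setCK; have := max_card (mem C); nia.
Qed.

(** Vertices are added one at a time. Injectivity of [c] leaves fewer than [r] earlier ones, so a
    proportion [1/m] of the values extends each good map. *)
Lemma card_multipartite_transversal J : 0 < #|G| -> {in J &, injective c} ->
  #|{ffun U -> G}| <= m ^ #|J| * #|multipartite J|.
Proof.
move=> Gpos; move: {2}#|J| (erefl #|J|) => k; elim: k J => [|k IH] J.
  move/eqP; rewrite cards_eq0 => /eqP -> _; rewrite cards0 mul1n subset_leq_card //.
  by apply/subsetP => f _; apply/multipartiteP => u v; rewrite inE.
move=> cJ; have /set0Pn[u uJ] : J != set0 by rewrite -card_gt0 cJ.
rewrite -(setD1K uJ) => inj; set K := J :\ u in inj *.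
have uK : u \notin K by rewrite !inE eqxx.
have cK : #|K| = k by move: cJ; rewrite (cardsD1 u) uJ add1n => -[].
have injK : {in K &, injective c}.
  by move=> v w vK wK; apply: inj; rewrite inE ?vK ?wK orbT.
have Kr : #|K| < r.
  have := max_card (mem (c @: (u |: K))).
  by rewrite card_in_imset // cardsU1 uK card_ord.
apply: leq_trans (IH K cK injK) _.
rewrite cardsU1 uK expnD expn1 -mulnA mulnCA leq_mul2l; apply/orP; right.
rewrite -(leq_pmul2l Gpos) mulnCA.
rewrite !card_setE -(sum_update (fun f => nat_of_bool (f \in multipartite (u |: K))) u).
rewrite !big_distrr leq_sum //= => f _.
case: multipartiteP => [fK|]; last by rewrite muln0.
rewrite muln1; apply: leq_trans (card_common_neighbours f Kr) _.
rewrite leq_mul2l; apply/orP; right.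
rewrite -sum1_card [leqLHS]big_mkcond leq_sum //= => x _; rewrite inE.
case: forall_inP => // xK; rewrite lt0b; apply/multipartiteP => v w.
have fE z : z \in K -> update f u x z = f z.
  by move=> zK; rewrite update_neq //; apply: contraNneq uK => <-.
rewrite !in_setU1 => /orP[/eqP ->|vK] /orP[/eqP ->|wK]; rewrite ?eqxx ?updateE // => cvw.
- by rewrite fE // adj_sym xK.
- by rewrite fE // xK.
- by rewrite !fE //; apply: fK.
Qed.

End Supersaturation.

(** * Counting maps with prescribed image points or collisions *)

Section Counting.
Variables U V : finType.

(* Outside [t] a function with [map f t = s] is arbitrary, and [t] is uniq as soon as [s] is. *)
Lemma card_ffun_map_eq k (t : k.-tuple U) (s : k.-tuple V) : uniq s ->
  #|[set f : {ffun U -> V} | map f t == s]| * #|V| ^ k <= #|{ffun U -> V}|.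
Proof.
move=> us; set A := [set f | _].
have [->|/set0Pn[f0]] := eqVneq A set0; first by rewrite cards0.
rewrite inE => /eqP f0t.
have ut : uniq t by apply: (@map_uniq _ _ f0); rewrite f0t.
have : #|A| <= #|family (fun a => if a \in t then pred1 (f0 a) else predT)|.
  apply/subset_leq_card/subsetP => f; rewrite inE -f0t => /eqP ft.
  apply/familyP => a; case: ifP => // at_; apply/eqP.
  by have /eq_in_map := ft; apply.
rewrite card_family foldrE big_map big_enum /= (bigID (mem t)) /=.
rewrite big1 => [|a ->]; last by rewrite card1.
rewrite mul1n (eq_bigr (fun => #|V|)) => [|a /negPf ->]; last by [].
rewrite prod_nat_const => le; rewrite card_ffun.
have -> : #|U| = #|[predC t]| + k.
  by rewrite addnC -(cardC (mem t)) (card_uniqP ut) size_tuple.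
by rewrite expnD leq_mul2r le orbT.
Qed.

(** Union bound over the [#|U| ^ k] tuples of possible preimages. *)
Lemma card_hitting k (s : k.-tuple V) : uniq s ->
  #|[set f : {ffun U -> V} | all (mem (codom f)) s]| * #|V| ^ k
    <= #|U| ^ k * #|{ffun U -> V}|.
Proof.
move=> us; set A := [set f | _].
have : #|A| <= \sum_(t : k.-tuple U) #|[set f : {ffun U -> V} | map f t == s]|.
  have sub : A \subset \bigcup_(t : k.-tuple U) [set f : {ffun U -> V} | map f t == s].
    apply/subsetP => f; rewrite inE => /allP fs; apply/bigcupP.
    have [t ft] : exists t : seq U, map f t = s.
      elim: (tval s) fs => [|x s' IH] fs; first by exists [::].
      have [t <-] : exists t, map f t = s'.
        by apply: IH => y ys; apply: fs; rewrite inE ys orbT.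
      by have /codomP[u ->] := fs x (mem_head _ _); exists (u :: t).
    have st : size t == k by rewrite -(size_map f) ft size_tuple.
    by exists (Tuple st); rewrite ?inE //= ft.
  exact: leq_trans (subset_leq_card sub) (card_bigcup_le _ _).
move=> le; apply: leq_trans (leq_mul le (leqnn _)) _.
rewrite big_distrl /= -[#|U| ^ k]card_tuple -sum_nat_const.
by apply: leq_sum => t _; apply: card_ffun_map_eq.
Qed.

(** Union bound over pairs of distinct points: each pair collides for exactly one map in [#|V|]. *)
Lemma card_noninjective :
  #|[set f : {ffun U -> V} | ~~ injectiveb f]| * #|V| <= #|U| ^ 2 * #|{ffun U -> V}|.
Proof.
pose P : pred (U * U) := fun p => p.1 != p.2.
pose C (p : U * U) := [set f : {ffun U -> V} | f p.1 == f p.2].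
have cardC p : P p -> #|C p| * #|V| = #|{ffun U -> V}|.
  move=> neq; rewrite mulnC -sum1_card big_mkcond /= -(sum_update _ p.1).
  rewrite -[RHS]sum1_card; apply: eq_bigr => f _.
  rewrite (bigD1 (f p.2)) //= inE updateE update_neq 1?eq_sym // eqxx.
  rewrite big1 // => x /negPf xf; rewrite inE updateE update_neq ?xf //.
  by rewrite eq_sym.
have sub : [set f : {ffun U -> V} | ~~ injectiveb f] \subset \bigcup_(p | P p) C p.
  apply/subsetP => f; rewrite inE => /injectivePn[u [v uv fuv]].
  by apply/bigcupP; exists (u, v); rewrite ?inE ?fuv.
apply: (@leq_trans ((\sum_(p | P p) #|C p|) * #|V|)).
  rewrite leq_mul2r; apply/orP; right.
  exact: leq_trans (subset_leq_card sub) (card_bigcup_le _ _).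
rewrite big_distrl /= (eq_bigr _ cardC) sum_nat_const leq_mul2r; apply/orP; right.
by rewrite -mulnn -card_prod max_card.
Qed.

End Counting.

(** * Positive density of homomorphisms, uniformly in [G] *)

Section Density.
Variables (U : finType) (r : nat) (c : U -> 'I_r) (m : nat).

(* Every vertex added to a transversal of the colour classes is a clone of one of
   its elements, and squares the density. *)
Lemma multipartite_density : exists K, forall G : sgraph, 0 < #|G| ->
  #|G| + m * (r.-1 * (#|G| - min_degree G)) <= m * #|G| ->
  #|{ffun U -> G}| <= K * #|multipartite c G setT|.
Proof.
(* The pick depends only on the colour of [u], so [J0] contains one vertex of each colour in use. *)
pose J0 := [set u | [pick v | c v == c u] == Some u].
have injJ0 : {in J0 &, injective c}.
  move=> u v; rewrite !inE => /eqP Hu /eqP Hv cuv.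
  by apply: Some_inj; rewrite -Hu -Hv cuv.
have coverJ0 u : exists2 v, v \in J0 & c v = c u.
  case E: [pick v | c v == c u] => [v|]; last first.
    by move: E; case: pickP => // /(_ u); rewrite eqxx.
  have cv : c v = c u by move: E; case: pickP => // w /eqP cw [<-].
  by exists v => //; rewrite inE cv E.
suff: forall k (J : {set U}), J0 \subset J -> #|J :\: J0| = k ->
    exists K, forall G : sgraph, 0 < #|G| ->
    #|G| + m * (r.-1 * (#|G| - min_degree G)) <= m * #|G| ->
    #|{ffun U -> G}| <= K * #|multipartite c G J|.
  by apply; last reflexivity; apply: subsetT.
elim=> [|k IH] J sJ cJ.
  have -> : J = J0.
    by apply/eqP; rewrite eqEsubset sJ -setD_eq0 -cards_eq0 cJ.
  exists (m.+1 ^ #|J0|) => G G0 deg.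
  apply: leq_trans (card_multipartite_transversal deg G0 injJ0) _.
  rewrite leq_mul2r; apply/orP; right.
  by case: #|J0| => // j; rewrite leq_exp2r.
have /set0Pn[u] : J :\: J0 != set0 by rewrite -card_gt0 cJ.
rewrite inE => /andP[uJ0 uJ]; pose L := J :\ u.
have sL : J0 \subset L by rewrite subsetD1 sJ.
have cL : #|L :\: J0| = k.
  have -> : L :\: J0 = (J :\: J0) :\ u.
    by apply/setP => z; rewrite !inE andbCA.
  by move: cJ; rewrite (cardsD1 u) in_setD uJ0 uJ => -[].
have [K HK] := IH L sL cL.
exists (K ^ 2) => G G0 deg.
have [v vJ0 cv] := coverJ0 u.
have uL : u \notin L by rewrite !inE eqxx.
have := card_multipartite_clone G (subsetP sL v vJ0) uL cv.
rewrite setD1K // => clone; have dense := HK G G0 deg.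
have F0 : 0 < #|{ffun U -> G}| by rewrite card_ffun expn_gt0 G0.
(* The square of [dense] is combined with [clone]; one factor [#|{ffun U -> G}|] cancels. *)
rewrite -(leq_pmul2l F0) mulnCA; apply: leq_trans (leq_mul (leqnn (K ^ 2)) clone).
by rewrite -expnMn mulnn leq_exp2r.
Qed.

End Density.

(** * Degrees and codegrees of embeddings, and the [H]-game *)

Section HGame.
Variables H G : sgraph.
Local Notation F := {ffun H -> G}.

Definition edge_image (f : F) : {set {set G}} :=
  [set [set f v | v in e] | e : {set H} in edges H].

Lemma edgesP (K : sgraph) (e : {set K}) :
  reflect (exists x y, adj x y /\ e = [set x; y]) (e \in edges K).
Proof.
apply: (iffP imset2P) => [[x y _]|[x [y [xy ->]]]].
  by rewrite inE => xy ->; exists x, y.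
by exists x y; rewrite ?inE.
Qed.

Lemma edge_image_codom f e : e \in edge_image f -> {subset e <= codom f}.
Proof. by case/imsetP=> d _ -> x /imsetP[v _ ->]; apply: codom_f. Qed.

Lemma edge_image_sub f : embedding f -> edge_image f \subset edges G.
Proof.
case/andP=> _ /forallP hom; apply/subsetP => _ /imsetP[_ /edgesP[x [y [xy ->]]] ->].
apply/edgesP; exists (f x), (f y); split.
  by have /forallP/(_ y)/implyP := hom x; apply.
by rewrite imsetU !imset_set1.
Qed.

Lemma card_edge_image f : #|edge_image f| <= #|edges H|.
Proof. exact: leq_imset_card. Qed.

Lemma card_edges : #|edges G| <= #|G| ^ 2.
Proof.
have sub : edges G \subset [set [set p.1; p.2] | p : G * G].
  by apply/subsetP => _ /edgesP[x [y [_ ->]]]; apply/imsetP; exists (x, y).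
apply: leq_trans (subset_leq_card sub) (leq_trans (leq_imset_card _ _) _).
by rewrite -mulnn -card_prod.
Qed.

(** Hitting one endpoint of [x] is enough here: the bound only pays for an opening move by
    Breaker. *)
Lemma embeddings_through_edge (P : {set F}) (x : {set G}) : {in P, forall f, embedding f} ->
  #|[set f in P | x \in edge_image f]| * #|G| <= #|H| * #|F|.
Proof.
move=> Pemb; set A := [set f in P | _].
have [->|/set0Pn[f]] := eqVneq A set0; first by rewrite cards0.
rewrite inE => /andP[fP /(subsetP (edge_image_sub (Pemb f fP)))].
case/edgesP=> a [b [_ xab]].
have := @card_hitting H G 1 [tuple a] isT; rewrite !expn1.
apply: leq_trans; rewrite leq_mul2r; apply/orP; right.
apply/subset_leq_card/subsetP => g; rewrite !inE => /andP[_ /edge_image_codom gx] /=.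
by rewrite gx // xab !inE eqxx.
Qed.

(* Two distinct edges span at least three vertices. *)
Lemma embeddings_through_edges (P : {set F}) (x y : {set G}) :
    {in P, forall f, embedding f} -> x != y ->
  #|[set f in P | (x \in edge_image f) && (y \in edge_image f)]| * #|G| ^ 3
    <= #|H| ^ 3 * #|F|.
Proof.
move=> Pemb xy; set A := [set f in P | _].
have [->|/set0Pn[f]] := eqVneq A set0; first by rewrite cards0.
rewrite inE => /and3P[fP xf yf].
have emb := subsetP (edge_image_sub (Pemb f fP)).
have adj_neq (u v : G) : adj u v -> u != v.
  by apply: contraTneq => ->; rewrite adj_irrefl.
have card2 z : z \in edge_image f -> #|z| = 2.
  by move/emb/edgesP=> [u [v [/adj_neq uv ->]]]; rewrite cards2 uv.
have /edgesP[a [b [/adj_neq ab xab]]] := emb x xf.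
have /subsetPn[d dy dx] : ~~ (y \subset x).
  by apply: contra xy => yx; rewrite eq_sym eqEcard yx !card2.
have uabd : uniq [tuple a; b; d].
  move: dx; rewrite xab !inE negb_or /= !inE !andbT => /andP[da db].
  by rewrite negb_or ab eq_sym da eq_sym db.
apply: leq_trans (card_hitting H uabd); rewrite leq_mul2r; apply/orP; right.
apply/subset_leq_card/subsetP => g; rewrite !inE => /and3P[_ gx gy] /=.
have cx := edge_image_codom gx; rewrite (edge_image_codom gy dy) andbT.
by rewrite !cx // xab !inE eqxx ?orbT.
Qed.

(** The three terms of the threshold pay for the rounds of play, a Breaker opening, and the
    non-injective maps, in this order. *)
Lemma maker_wins_many_homs (S : {set F}) (K : nat) first :
    {in S, forall f : F, forall x y : H, adj x y -> adj (f x) (f y)} ->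
    #|F| <= K * #|S| ->
    K * (2 ^ #|edges H| * #|H| ^ 3 + #|H| + #|H| ^ 2) < #|G| ->
  maker_wins_H_game 1 H G first.
Proof.
move=> Shom dense large; pose P := [set f in S | injectiveb f].
have G0 : 0 < #|G| by apply: leq_ltn_trans large.
have F0 : 0 < #|F| by rewrite card_ffun expn_gt0 G0.
have Pemb : {in P, forall f, embedding f}.
  move=> f; rewrite inE => /andP[fS inj]; rewrite /embedding inj.
  by apply/forallP => x; apply/forallP => y; apply/implyP; apply: Shom.
pose D1 := (#|H| * #|F|) %/ #|G|; pose D2 := (#|H| ^ 3 * #|F|) %/ #|G| ^ 3.
apply: (@maker_wins_potential _ _ _ _ P edge_image #|edges H| D1 D2).
- by move=> f fP; apply/imsetP; exists f; rewrite ?inE ?Pemb.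
- by move=> f fP; apply/edge_image_sub/Pemb.
- by move=> f _; apply: card_edge_image.
- by move=> x; rewrite leq_divRL //; apply: embeddings_through_edge.
- by move=> x y xy; rewrite leq_divRL ?expn_gt0 ?G0 //; apply: embeddings_through_edges.
have noninj := card_noninjective H G; set I := #|_| in noninj.
have SP : #|S| <= #|P| + I.
  apply: leq_trans (leq_card_setU _ _).1; apply/subset_leq_card/subsetP => f fS.
  by rewrite !inE fS; case: injectiveb.
have D1n : D1 * #|G| <= #|H| * #|F| by apply: leq_divM.
have D2n : D2 * #|G| ^ 3 <= #|H| ^ 3 * #|F| by apply: leq_divM.
rewrite ltnNge; apply/negP => few.
set c := (X in K * X) in large.
(* If the criterion failed, the three losses would bound [#|S|] in this way, and [dense] would force
   [#|G| <= K * c], against [large]. *)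
suff: #|G| * #|S| <= c * #|F|.
  move=> le; have : #|G| * #|F| <= K * c * #|F|.
    by rewrite -mulnA (leq_trans _ (leq_mul (leqnn K) le)) // mulnCA leq_mul2l dense orbT.
  by rewrite leq_pmul2r // leqNgt large.
have Xn : #|edges G| * (2 ^ #|edges H| * D2) * #|G| <= 2 ^ #|edges H| * (#|H| ^ 3 * #|F|).
  apply: leq_trans (leq_mul (leqnn _) D2n).
  apply: (@leq_trans (#|G| ^ 2 * (2 ^ #|edges H| * D2) * #|G|)).
    by rewrite !leq_mul ?card_edges.
  by rewrite [#|G| ^ 3]expnSr; nia.
rewrite /c !mulnDl -mulnA; nia.
Qed.

End HGame.

(** * From the chromatic number and the real degree bound to the final result *)

Lemma chromatic_coloring (H : sgraph) :
  exists c : H -> 'I_(chromatic_number H), forall x y, adj x y -> c x != c y.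
Proof.
rewrite /chromatic_number; case: ex_minnP => k /existsP[c /forallP cP] _.
by exists c => x y xy; have /forallP/(_ y)/implyP := cP x; apply.
Qed.

Local Open Scope ring_scope.

Lemma excess_degree_nat (R : realType) (r : nat) (alpha : R) :
    (2 <= r)%N -> (r%:R - 2) / (r%:R - 1) < alpha ->
  exists m : nat, forall n d : nat, (d <= n)%N -> alpha * n%:R <= d%:R ->
    (n + m * (r.-1 * (n - d)) <= m * n)%N.
Proof.
case: r => [|r] //; rewrite ltnS => r0.
have r0R : 0 < r%:R :> R by rewrite ltr0n.
rewrite -natr1 addrK ltr_pdivrMr // => lt_alpha.
(* Here [r] is one less than the chromatic number, and [gap] is the proportion of vertices surviving
   [r] exclusions; the lower bound on [alpha] makes it positive. *)
pose gap := 1 - r%:R * (1 - alpha).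
have gap0 : 0 < gap by rewrite /gap; lra.
pose m := Num.bound gap^-1.
have m_gap : 1 <= m%:R * gap.
  by rewrite -ler_pdivrMr // div1r ltW // archi_boundP // invr_ge0 ltW.
exists m => n d dn alpha_d.
rewrite -(ler_nat R) !(natrD, natrM, natrB) //=.
have n0 : 0 <= n%:R :> R by [].
have m0 : 0 <= m%:R :> R by [].
apply: (@le_trans _ _ (m%:R * gap * n%:R + m%:R * (r%:R * (n%:R - alpha * n%:R)))).
  rewrite lerD ?ler_peMl // !ler_wpM2l // ?ler0n //; lra.
by rewrite /gap le_eqVlt; apply/orP; left; apply/eqP; ring.
Qed.

Theorem theorem1p1 (R : realType) (r : nat) (hr : (2 <= r)%N) (alpha : R)
    (halpha_gt : (r%:R - 2) / (r%:R - 1) < alpha)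
    (halpha_le : alpha <= (r%:R - 1) / r%:R)
    (H : sgraph) (hH : chromatic_number H = r) :
  exists n0 : nat, forall (n : nat) (G : sgraph),
    (n0 <= n)%N -> #|G| = n -> alpha * n%:R <= (min_degree G)%:R ->
    forall first : player, maker_wins_H_game 1 H G first.
Proof.
have [c col] := chromatic_coloring H; rewrite hH in c col.
have [m deg] := excess_degree_nat hr halpha_gt.
have [K dense] := multipartite_density c m.
(* The threshold of [maker_wins_many_homs]; the successor gives strictness and makes [G]
   nonempty. *)
exists (K * (2 ^ #|edges H| * #|H| ^ 3 + #|H| + #|H| ^ 2)).+1%N.
move=> n G large Gn degG first; rewrite -Gn in large degG.
apply: (@maker_wins_many_homs _ _ (multipartite c G setT) K) => //.
- move=> f /multipartiteP fP x y xy; apply: fP; rewrite ?inE //; exact: col.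
- by apply: dense; [apply: leq_trans large|apply: deg => //; apply: min_degree_le_card].
Qed.
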